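(* Let $(H,\mathcal B)$ be a commutative fusion ring whose dual hypergroup $\widehat{(H,\mathcal B)}$ is $h$-integral. Let $a\in\mathcal B$ be a standard element with $\mathrm{FPdim}(a)>1$. Then there is an algebra morphism $\mu\in\widehat{\mathcal B}$ such that $\mu(a)=0$.
   Context: A (commutative) fusion ring $(H,\mathcal B)$: a finite-dimensional commutative unital associative $\mathbb C$-algebra $H$ with a $\mathbb C$-basis $\mathcal B=\{x_1=1,x_2,\dots,x_m\}$ (its elements are called standard elements) such that $x_ix_j=\sum_k N_{i,j}^k x_k$ with $N_{i,j}^k\in\mathbb Z_{\ge 0}$, together with an involution $i\mapsto i^*$ of $\{1,\dots,m\}$ such that $N_{i,j}^1=\delta_{j,i^*}$; the involution $x_i\mapsto x_i^*:=x_{i^*}$ extends to an anti-involution of $H$, i.e. $N_{i,j}^k=N_{j^*,i^*}^{k^*}$. $\mathrm{FPdim}:H\to\mathbb C$ is the unique algebra morphism taking positive values on $\mathcal B$ ($\mathrm{FPdim}(x_i)$ is the Frobenius–Perron eigenvalue of left multiplication by $x_i$). Put $d_i=\mathrm{FPdim}(x_i)$. $\widehat{\mathcal B}=\{\mu_1=\mathrm{FPdim},\mu_2,\dots,\mu_m\}$ is the set of all unital algebra morphisms $H\to\mathbb C$; it is a basis of $H^*$. The dual hypergroup $\widehat{(H,\mathcal B)}$ is $H^*$ with basis $\widehat{\mathcal B}$ and product determined by $(f\star g)(x_i/d_i)=f(x_i/d_i)\,g(x_i/d_i)$, unit $\mu_1$, and involution $\mu_j\mapsto\mu_{j^\#}$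 where $\mu_{j^\#}(x_i)=\mu_j(x_{i^*})$. Write $\mu_i\star\mu_j=\sum_k\widehat p_k(i,j)\mu_k$ and $\widehat h_j:=1/\widehat p_1(j,j^\#)$. The dual is called $h$-integral if $\widehat h_j\in\mathbb Z$ for all $j$. *)

(* Defs.v *)
From HB Require Import structures.
From mathcomp Require Import all_boot all_order all_algebra all_field.

Set Implicit Arguments.
Unset Strict Implicit.
Unset Printing Implicit Defensive.

Import Order.TTheory GRing.Theory Num.Theory.
Local Open Scope ring_scope.

(* The standard elements x_1 = 1, ..., x_m are numbered from 0, and m = r.+1
   where r is the field fr_rank. *)
Record fusionRing (C : numClosedFieldType) := FusionRing {
  fr_alg :> falgType C;
  fr_mulC : commutative (@GRing.mul fr_alg);
  fr_rank : nat;
  std : fr_rank.+1.-tuple fr_alg;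
  std_basis : basis_of {:fr_alg} std;
  std_1 : tnth std ord0 = 1;
  N : 'I_fr_rank.+1 -> 'I_fr_rank.+1 -> 'I_fr_rank.+1 -> nat;
  std_mul : forall i j,
    tnth std i * tnth std j = \sum_k (N i j k)%:R *: tnth std k;
  star : 'I_fr_rank.+1 -> 'I_fr_rank.+1;
  starK : involutive star;
  N_1 : forall i j, N i j ord0 = (j == star i);
  N_star : forall i j k, N i j k = N (star j) (star i) (star k)
}.

Section Dual.

Variables (C : numClosedFieldType) (H : fusionRing C).

(* 'AHom(H, C^o) is the type of unital algebra morphisms H -> C, a subtype of
   the linear dual 'Hom(H, C^o). *)

(* FPdim is the unique algebra morphism with this property. *)
Definition is_FPdim (f : 'AHom(H, C^o)) : Prop :=
  forall i, 0 < (f (tnth (std H) i) : C).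

(* An enumeration mu_1 = FPdim, mu_2, ..., mu_m, without repetition, of all
   the unital algebra morphisms, with the involution j |-> j^# of the indices.
   It is a basis of H^*: see dual_basis below. *)
Record dualBasis (FPdim : 'AHom(H, C^o)) := DualBasis {
  mu : (fr_rank H).+1.-tuple 'AHom(H, C^o);
  mu_uniq : uniq mu;
  mu_all : forall f : 'AHom(H, C^o), f \in mu;
  mu_1 : tnth mu ord0 = FPdim;
  sharp : 'I_(fr_rank H).+1 -> 'I_(fr_rank H).+1;
  mu_sharp : forall j i,
    tnth mu (sharp j) (tnth (std H) i) = tnth mu j (tnth (std H) (star i))
}.

Variables (FPdim : 'AHom(H, C^o)) (B : dualBasis FPdim).

Definition fpd i : C := FPdim (tnth (std H) i).

(* The product f * g of H^*, extended linearly from its values at the x_i;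
   those values are characterized by dual_mulP. *)
Definition dual_mul_fun (f g : 'Hom(H, C^o)) (v : H) : C^o :=
  \sum_i coord (std H) i v *
    (fpd i * (f ((fpd i)^-1 *: tnth (std H) i) *
              g ((fpd i)^-1 *: tnth (std H) i))).

Definition dual_mul (f g : 'Hom(H, C^o)) : 'Hom(H, C^o) :=
  linfun (dual_mul_fun f g).

Definition dual_elts : (fr_rank H).+1.-tuple 'Hom(H, C^o) :=
  map_tuple (fun f : 'AHom(H, C^o) => f : 'Hom(H, C^o)) (mu B).

(* phat k i j is the coefficient of mu_k in mu_i * mu_j. *)
Definition phat k i j : C :=
  coord dual_elts k (dual_mul (tnth dual_elts i) (tnth dual_elts j)).

Definition hhat j : C := 1 / phat ord0 j (sharp B j).

Definition h_integral : Prop :=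
  forall j, exists z : int, hhat j = z%:~R.

Lemma dual_mul_fun_linear f g : linear (dual_mul_fun f g).
Proof.
move=> a u v; rewrite /dual_mul_fun scaler_sumr -big_split /=.
apply: eq_bigr => i _; rewrite linearP /= mulrDl.
by rewrite -mulrA.
Qed.

Lemma dual_mulE f g v : dual_mul f g v = dual_mul_fun f g v.
Proof.
pose F := GRing.isLinear.Build _ _ _ _ _ (dual_mul_fun_linear f g).
pose L : {linear H -> C^o} := HB.pack (dual_mul_fun f g) F.
exact: (lfunE L v).
Qed.

Lemma dual_mulP (FP_gt0 : is_FPdim FPdim) f g i :
  let y := (fpd i)^-1 *: tnth (std H) i in
  dual_mul f g y = f y * g y.
Proof.
move=> y; have di_neq0 : fpd i != 0 by rewrite gt_eqF // FP_gt0.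
have xiE k : coord (std H) k (tnth (std H) i) = (i == k)%:R.
  by rewrite (tnth_nth 0) coord_free // (basis_free (std_basis H)).
rewrite dual_mulE /dual_mul_fun (bigD1 i) //= big1 ?addr0 => [|k kNi].
  by rewrite linearZ /= xiE eqxx mulr1; exact: mulKf.
by rewrite linearZ /= xiE eq_sym (negPf kNi) mulr0 mul0r.
Qed.

(* Dedekind's independence of characters *)
Lemma ahom_indep (s : seq 'AHom(H, C^o)) (c : 'AHom(H, C^o) -> C) :
    uniq s -> (forall v : H, \sum_(f <- s) c f * (f v : C) = 0) ->
  forall f, f \in s -> c f = 0.
Proof.
elim: s c => [|f s IHs] c //= /andP[fNs s_uniq] cs0.
have cs g : g \in s -> c g = 0.
  move=> gs; have [y gfy] : exists y : H, (g y : C) - f y != 0.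
    have: (g : 'Hom(H, C^o)) != f.
      by apply: contraNneq fNs => /val_inj <-.
    move/eqP=> gNf; have [/existsP[i iP]|/existsPn noi] :=
      boolP [exists i, (g (tnth (std H) i) : C) - f (tnth (std H) i) != 0].
      by exists (tnth (std H) i).
    case: gNf; apply/(fullv_lfunP _ _ (span_basis (std_basis H))).
    move=> _ /tnthP[i ->].
    by apply/eqP; rewrite -subr_eq0; have := noi i; rewrite negbK.
  suff /eqP: c g * ((g y : C) - f y) = 0.
    by rewrite mulf_eq0 (negPf gfy) orbF => /eqP.
  apply: (IHs (fun g => c g * ((g y : C) - f y))) => // v.
  pose S w : C := \sum_(h <- f :: s) c h * (h w : C).
  have S0 w : S w = 0 := cs0 w.
  have: S (y * v) - (f y : C) * S v = 0 by rewrite !S0 mulr0 subrr.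
  rewrite /S mulr_sumr -sumrB big_cons rmorphM /= mulrCA subrr add0r => csum.
  rewrite -[RHS]csum.
  apply: eq_bigr => h _; rewrite rmorphM /= -mulrA mulrBl mulrBr.
  by congr (_ - _); rewrite mulrCA.
move=> g; rewrite inE => /predU1P[->|/cs //].
have := cs0 1; rewrite big_cons rmorph1 mulr1 big_seq big1 ?addr0 // => h hs.
by rewrite cs // mul0r.
Qed.

Lemma dual_basis : basis_of {:'Hom(H, C^o)} dual_elts.
Proof.
have dimH : \dim {:'Hom(H, C^o)} = (fr_rank H).+1.
  by rewrite dimvf /dim /= muln1 -[dim _]dimvf -(size_basis (std_basis H)).
rewrite basisEfree subvf size_tuple dimH leqnn !andbT.
apply/freeP => c cs0 i; pose k f := c (inord (index f (mu B))).
have muP j : index (tnth (mu B) j) (mu B) = j.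
  by rewrite (tnth_nth FPdim) index_uniq ?size_tuple ?mu_uniq.
rewrite (_ : c i = k (tnth (mu B) i)); last by rewrite /k muP inord_val.
apply: (ahom_indep (s := mu B)) (mem_tnth _ _); first exact: mu_uniq.
move=> v; rewrite big_tuple; have /lfunP/(_ v) := cs0.
rewrite sum_lfunE lfunE /= => cs0v; rewrite -[RHS]cs0v.
apply: eq_bigr => j _; rewrite /k muP inord_val scale_lfunE.
by rewrite -tnth_nth tnth_map.
Qed.

End Dual.

(* Main.v *)
(* Let n_j = sum_i |mu_j(x_i)|^2. Column orthogonality of the matrix (mu_j(x_i))
   gives h_j = FPdim(H) / n_j for the dual numbers h_j of the statement, and
   sum_j h_j |mu_j(a)|^2 = FPdim(H) = sum_j h_j, so by AM-GM the product P of the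
   mu_j(a)^(h_j) has norm at most 1, with equality only if all |mu_j(a)| are 1,
   which contradicts FPdim(a) > 1. If no mu_j(a) vanishes then |P| >= 1. Instead
   of Galois theory: as the h_j are integers, j |-> mu_j(a)^(k h_j) takes the
   values of the mu_j at an element of the rational span of the standard basis,
   whose denominator M is independent of k. The determinant of the multiplication
   by M times this element is the integer M^m P^k, for all k, so |P| >= 1. *)
Require Import Defs.
From mathcomp Require Import all_boot all_order all_algebra all_field.
From mathcomp Require Import reals complex zify.

Set Implicit Arguments.
Unset Strict Implicit.
Unset Printing Implicit Defensive.

Import Order.TTheory GRing.Theory Num.Theory.

Local Open Scope ring_scope.

(** * Numerical inequalities *)

(** Bernoulli's inequality (1 + 1/s)^k >= 1 + k/s with denominators cleared, a form that also makes
    sense for s = 0. *)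
Lemma Bernoulli_nat s k : (s ^ k * (s + k) <= s.+1 ^ k * s)%N.
Proof.
elim: k => [|k IHk]; first by rewrite !expn0 addn0.
rewrite !expnS; nia.
Qed.

(** For p < 1 the positive integers t p^k would fall below 1. As [F] need not be archimedean, the
    case k = 1 first gives p = s/t, and the rest compares powers of natural numbers. *)
Lemma ge1_of_bounded_denominators (F : numFieldType) (t : nat) (p : F) :
  (0 < t)%N -> 0 < p -> (forall k, exists s : nat, t%:R * p ^+ k = s%:R) ->
  1 <= p.
Proof.
move=> t_gt0 p_gt0 tp; have t0 : 0 < t%:R :> F by rewrite ltr0n.
have [s /= es] := tp 1; rewrite expr1 in es.
have ep : p = s%:R / t%:R by rewrite -es mulrAC divff ?mul1r ?gt_eqF.
have s_gt0 : (0 < s)%N by rewrite -(ltr0n F) -es mulr_gt0.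
rewrite ep ler_pdivlMr // mul1r ler_nat leqNgt; apply/negP => s_lt_t.
have le_tk k : (t ^ k <= t * s ^ k)%N.
  have [u eu] := tp k; rewrite -(ler_nat F) natrM !natrX.
  have -> : t%:R * s%:R ^+ k = t%:R ^+ k * u%:R :> F.
    by rewrite -eu ep expr_div_n mulrCA [t%:R ^+ k * _]mulrC divfK
         ?expf_neq0 ?gt_eqF.
  rewrite ler_peMr ?exprn_ge0 ?ler0n // ler1n lt0n -(eqr_nat F) -eu.
  by rewrite mulf_neq0 ?expf_neq0 ?gt_eqF.
(* With exponent ts, Bernoulli yields (s+1)^(ts) >= (t+1) s^(ts), against (s+1)^(ts) <= t^(ts) <= t
   s^(ts). *)
have := Bernoulli_nat s (t * s).
have : (s.+1 ^ (t * s) <= t ^ (t * s))%N.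
  by case: (t * s)%N => // k; rewrite leq_exp2r.
have : (0 < s ^ (t * s))%N by rewrite expn_gt0 s_gt0.
have := le_tk (t * s)%N; nia.
Qed.

Lemma weighted_AGM (F : numFieldType) (I : finType) (h : I -> nat)
    (E : I -> F) :
  (forall i, 0 <= E i) -> \sum_i (h i)%:R * E i = \sum_i (h i)%:R ->
  1 <= \prod_i E i ^+ h i -> forall i, (0 < h i)%N -> E i = 1.
Proof.
move=> E_ge0 sumE prodE i0 hi0.
(* [T] repeats each index i exactly [h i] times, which reduces the claim to the equality case of the
   unweighted AM-GM inequality: the mean is 1 and the product at least 1. *)
pose T : finType := {i : I & 'I_(h i)} : finType.
pose G (u : T) := E (tag u).
have sumT (K : I -> F) : \sum_(u : T) K (tag u) = \sum_i (h i)%:R * K i.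
  rewrite -(@sig_big_dep _ _ _ _ (fun i => ordinal (h i)) predT
    (fun=> predT) (fun i _ => K i)).
  by apply: eq_bigr => i _; rewrite sumr_const card_ord mulr_natl.
have cardT : #|T|%:R = \sum_i (h i)%:R :> F.
  under eq_bigr do rewrite -[_%:R]mulr1.
  by rewrite -(sumT (fun=> 1)) sumr_const.
have prodT : \prod_(u : T) G u = \prod_i E i ^+ h i.
  rewrite -(@sig_big_dep _ _ _ _ (fun i => ordinal (h i)) predT
    (fun=> predT) (fun i _ => E i)).
  by apply: eq_bigr => i _; rewrite prodr_const card_ord.
have T_gt0 : (0 < #|T|)%N.
  by apply/card_gt0P; exists (Tagged (fun i => 'I_(h i)) (Ordinal hi0)).
have T_neq0 : #|T|%:R != 0 :> F by rewrite pnatr_eq0 -lt0n.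
have [] := @leif_AGM F T predT G (fun u _ => E_ge0 _).
have -> : \sum_(u in T) G u = #|T|%:R by rewrite cardT -sumE -sumT.
rewrite divff // expr1n prodT => le1 /esym.
rewrite eq_le le1 prodE /= => /forall_inP eqG.
have eq0 (u : T) : G u = E i0.
  have /forall_inP/(_ (Tagged (fun i => 'I_(h i)) (Ordinal hi0)))/(_ isT) :=
    eqG u isT.
  by move/eqP.
apply: (mulfI T_neq0); rewrite mulr1 [in RHS]cardT -sumE -sumT.
rewrite (eq_bigr (fun=> E i0)) => [|u _]; last exact: eq0.
by rewrite sumr_const mulr_natl.
Qed.

(** * Structure constants and orthogonality of characters *)

Section FusionRing.

Variables (C : numClosedFieldType) (H : fusionRing C).

Local Notation x := (tnth (std H)).
Local Notation tau := (coord (std H) ord0).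

Lemma coord_std i j : coord (std H) i (x j) = (i == j)%:R.
Proof.
by rewrite (tnth_nth 0) coord_free ?(basis_free (std_basis H)) // eq_sym.
Qed.

Lemma eq_star (i j : 'I_(fr_rank H).+1) : (i == star j) = (j == star i).
Proof. by rewrite -(can2_eq (@starK _ H) (@starK _ H)) eq_sym. Qed.

Lemma coord0_mul i j : tau (x i * x j) = (j == star i)%:R.
Proof.
rewrite std_mul linear_sum (bigD1 ord0) //= linearZ /= coord_std eqxx mulr1.
rewrite N_1 big1 ?addr0 // => k k0.
by rewrite linearZ /= coord_std eq_sym (negPf k0) mulr0.
Qed.

(** By commutativity the left side is symmetric in the three indices; the symmetries of [N] below
    come from this. *)
Lemma coord0_mul3 i l q : tau (x i * x l * x q) = (N i l (star q))%:R.
Proof.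
rewrite std_mul mulr_suml linear_sum (bigD1 (star q)) //= -scalerAl linearZ /=.
rewrite coord0_mul starK eqxx mulr1 big1 ?addr0 // => k kq.
by rewrite -scalerAl linearZ /= coord0_mul eq_star (negPf kq) mulr0.
Qed.

Lemma Frobenius_reciprocity (i l k : 'I_(fr_rank H).+1) :
  N i l k = N (star i) k l.
Proof.
apply/eqP; rewrite -(eqr_nat C) N_star -coord0_mul3.
by rewrite fr_mulC mulrA fr_mulC mulrA coord0_mul3 starK.
Qed.

Lemma structure_constC (i l k : 'I_(fr_rank H).+1) : N i l k = N l i k.
Proof.
by apply/eqP; rewrite -(eqr_nat C) -[k]starK -!coord0_mul3 [x i * _]fr_mulC.
Qed.

Lemma ahom_std_mul (f : 'AHom(H, C^o)) i l :
  (f (x i) : C) * f (x l) = \sum_k (N i l k)%:R * (f (x k) : C).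
Proof.
rewrite -[LHS](rmorphM f) std_mul /= linear_sum.
by apply: eq_bigr => k _; rewrite linearZ.
Qed.

Lemma ahom_std0 (f : 'AHom(H, C^o)) : f (x ord0) = 1 :> C.
Proof. by rewrite std_1 rmorph1. Qed.

(** The formal codegree of the character; for FPdim it is FPdim(H). Writing it with [star] rather
    than with norms makes it visibly the value of f at an integral combination of standard
    elements. *)
Definition codegree (f : 'AHom(H, C^o)) : C :=
  \sum_i (f (x i) : C) * f (x (star i)).

(* The values f (x l) are the entries of a common eigenvector of the matrices
   (N i), and the transpose of N i is N (star i). *)
Lemma ahom_star (f : 'AHom(H, C^o)) i : f (x (star i)) = (f (x i) : C)^* :> C.
Proof.
pose S := \sum_l (f (x l) : C) * (f (x l) : C)^*.
have S_neq0 : S != 0.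
  rewrite gt_eqF // /S (bigD1 ord0) //= ahom_std0 rmorph1 mulr1.
  by rewrite ltr_wpDr ?ltr01 ?sumr_ge0 // => l _; rewrite -normCK exprn_ge0.
apply: (mulIf S_neq0); rewrite /S !mulr_sumr.
under eq_bigr => l _ do rewrite mulrA ahom_std_mul mulr_suml.
rewrite exchange_big; apply: eq_bigr => l _ /=.
rewrite mulrCA -rmorphM ahom_std_mul rmorph_sum mulr_sumr.
apply: eq_bigr => k _.
by rewrite rmorphM /= rmorph_nat -Frobenius_reciprocity mulrCA mulrA.
Qed.

Lemma codegreeE f : codegree f = \sum_i `|f (x i) : C| ^+ 2.
Proof. by apply: eq_bigr => i _; rewrite ahom_star normCK. Qed.

Lemma codegree_gt0 f : 0 < codegree f.
Proof.
rewrite codegreeE (bigD1 ord0) //= ahom_std0 normr1 expr1n.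
by rewrite ltr_wpDr ?ltr01 ?sumr_ge0 // => l _; rewrite exprn_ge0.
Qed.

Lemma ahom_eq (f g : 'AHom(H, C^o)) :
  (forall i, f (x i) = g (x i) :> C) -> f = g.
Proof.
move=> fg; apply/val_inj/(fullv_lfunP _ _ (span_basis (std_basis H))).
by move=> _ /tnthP[i ->]; apply: fg.
Qed.

Lemma ahom_orthogonal (f g : 'AHom(H, C^o)) : f != g ->
  \sum_i (f (x i) : C) * g (x (star i)) = 0.
Proof.
apply: contraNeq => T_neq0; apply/eqP/ahom_eq => l; apply: (mulIf T_neq0).
rewrite !mulr_sumr.
under eq_bigr => i _ do rewrite mulrA ahom_std_mul mulr_suml.
rewrite exchange_big; apply: eq_bigr => p _ /=.
rewrite mulrCA ahom_std_mul mulr_sumr (reindex_inj (can_inj (@starK _ H))) /=.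
apply: eq_bigr => i _; rewrite starK mulrCA mulrA.
by rewrite Frobenius_reciprocity N_star !starK structure_constC.
Qed.

End FusionRing.

(** * The dual numbers [hhat] as ratios of codegrees *)

Section Dual.

Variables (C : numClosedFieldType) (H : fusionRing C).
Variables (FPdim : 'AHom(H, C^o)) (B : dualBasis FPdim).

Local Notation x := (tnth (std H)).
Local Notation chi := (tnth (mu B)).

Lemma mu_orthogonal j k :
  \sum_i (chi j (x i) : C) * chi k (x (star i)) =
    (j == k)%:R * codegree (chi j).
Proof.
have [<-|jk] := eqVneq j k; first by rewrite mul1r.
rewrite mul0r ahom_orthogonal //; apply: contraNneq jk => /eqP.
by rewrite (inj_eq (tuple_uniqP _ (mu_uniq B))).
Qed.

Let codegree_neq0 j : codegree (chi j) != 0.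
Proof. by rewrite gt_eqF ?codegree_gt0. Qed.

Definition character_table : 'M[C]_((fr_rank H).+1) :=
  \matrix_(i, j) (chi j (x i) : C).

(** Orthogonality of the characters gives a left inverse. For a square matrix it is also a right
    inverse, which is the second orthogonality relation, between standard elements. *)
Lemma character_table_inv :
  character_table *m
    \matrix_(j, i) ((chi j (x (star i)) : C) / codegree (chi j)) = 1%:M.
Proof.
apply: mulmx1C; apply/matrixP => j k; rewrite !mxE.
transitivity ((\sum_i (chi k (x i) : C) * chi j (x (star i))) /
              codegree (chi j)).
  rewrite mulr_suml; apply: eq_bigr => i _.
  by rewrite !mxE mulrC mulrA.
by rewrite mu_orthogonal eq_sym; case: eqP => [->|_];
  rewrite ?mul1r ?divff ?mul0r.
Qed.

Lemma sum_norm_mu i : \sum_j `|chi j (x i) : C| ^+ 2 / codegree (chi j) = 1.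
Proof.
have /matrixP/(_ i i) := character_table_inv; rewrite !mxE eqxx; apply: etrans.
by apply: eq_bigr => j _; rewrite !mxE ahom_star normCK mulrA.
Qed.

Hypothesis FPdim_gt0 : is_FPdim FPdim.

Lemma FPdim_star i : FPdim (x (star i)) = FPdim (x i) :> C.
Proof. by rewrite ahom_star (CrealP _) // realE ltW ?FPdim_gt0. Qed.

Lemma dual_mul_std (f g : 'Hom(H, C^o)) i :
  (dual_mul FPdim f g (x i) : C) * fpd FPdim i = (f (x i) : C) * g (x i).
Proof.
have d_neq0 : fpd FPdim i != 0 by rewrite gt_eqF ?FPdim_gt0.
have := dual_mulP FPdim_gt0 f g i; rewrite /= !linearZ /= => e.
apply: (mulfI (invr_neq0 d_neq0)); apply: (mulfI (invr_neq0 d_neq0)).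
transitivity ((fpd FPdim i)^-1 * (dual_mul FPdim f g (x i) : C)).
  by congr (_ * _); rewrite mulrC mulfK.
by rewrite [LHS]e -[LHS]mulrA; congr (_ * _); rewrite [LHS]mulrCA.
Qed.

(** Pair the product of mu_j and its [sharp] with FPdim: expanded in the mu_k, only the FPdim term
    survives by orthogonality; evaluated directly, the factor d_i cancels and the codegree of mu_j
    remains. *)
Lemma phat_codegree j :
  phat B ord0 j (sharp B j) * codegree FPdim = codegree (chi j).
Proof.
transitivity (\sum_i (dual_mul FPdim (chi j) (chi (sharp B j)) (x i) : C)
                       * FPdim (x (star i))); last first.
  by apply: eq_bigr => i _; rewrite FPdim_star dual_mul_std mu_sharp.
have e i : (dual_mul FPdim (chi j) (chi (sharp B j)) (x i) : C) =
    \sum_k phat B k j (sharp B j) * (chi k (x i) : C).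
  set g := dual_mul _ _ _.
  rewrite [g](coord_basis (dual_basis B) (memvf g)) sum_lfunE.
  apply: eq_bigr => k _.
  by rewrite scale_lfunE -tnth_nth /phat !tnth_map.
under eq_bigr => i _ do rewrite e mulr_suml.
rewrite exchange_big (bigD1 ord0) //= [X in _ + X]big1 ?addr0 => [|k k0].
  by rewrite /codegree mulr_sumr mu_1; apply: eq_bigr => i _; rewrite mulrA.
under eq_bigr => i _ do rewrite -mulrA.
have := mu_orthogonal k ord0; rewrite (negPf k0) mul0r mu_1 => orth.
by rewrite -mulr_sumr orth mulr0.
Qed.

Lemma hhatE j : hhat B j = codegree FPdim / codegree (chi j).
Proof.
have D_neq0 : codegree FPdim != 0 by rewrite gt_eqF ?codegree_gt0.
have p_neq0 : phat B ord0 j (sharp B j) != 0.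
  apply: contraNneq (codegree_neq0 j) => p0.
  by rewrite -phat_codegree p0 mul0r.
by rewrite /hhat -phat_codegree mul1r invfM mulrC -mulrA mulVf ?mulr1.
Qed.

Lemma sum_hhat_norm i :
  \sum_j hhat B j * `|chi j (x i) : C| ^+ 2 = codegree FPdim.
Proof.
rewrite -[RHS]mulr1 -(sum_norm_mu i) mulr_sumr; apply: eq_bigr => j _.
by rewrite hhatE mulrAC -[LHS]mulrA.
Qed.

End Dual.

(** * Integral functions on the set of characters *)

Section IntegralFunctions.

Variables (C : numClosedFieldType) (H : fusionRing C).
Variables (FPdim : 'AHom(H, C^o)) (B : dualBasis FPdim).

Local Notation x := (tnth (std H)).
Local Notation chi := (tnth (mu B)).
Local Notation m := (fr_rank H).+1.
Local Notation X := (character_table B).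

(* The Gelfand transforms j |-> mu_j(y) of the elements y of the integral span
   of the standard basis: A is the matrix of multiplication by y. *)
Definition integral_fun (c : 'I_m -> C) : Prop :=
  exists A : 'M[int]_m, map_mx intr A *m X = X *m diag_mx (\row_j c j).

Lemma eq_integral_fun c d : c =1 d -> integral_fun c -> integral_fun d.
Proof.
move=> cd [A eA]; exists A; rewrite eA; congr (_ *m diag_mx _).
by apply/rowP => j; rewrite !mxE cd.
Qed.

Lemma integral_fun_std i : integral_fun (fun j => chi j (x i)).
Proof.
exists (\matrix_(k, l) (N i k l)%:Z); apply/matrixP => k j.
rewrite mul_mx_diag !mxE mulrC ahom_std_mul; apply: eq_bigr => l _.
by rewrite !mxE.
Qed.

Lemma integral_fun_int (z : int) : integral_fun (fun=> z%:~R).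
Proof.
exists z%:M; rewrite map_scalar_mx mul_scalar_mx.
by apply/matrixP => k j; rewrite mul_mx_diag !mxE mulrC.
Qed.

Lemma integral_funD c d :
  integral_fun c -> integral_fun d -> integral_fun (fun j => c j + d j).
Proof.
move=> [A eA] [A' eA']; exists (A + A').
rewrite map_mxD mulmxDl eA eA' -mulmxDr -raddfD; congr (_ *m diag_mx _).
by apply/rowP => j; rewrite !mxE.
Qed.

Lemma integral_funM c d :
  integral_fun c -> integral_fun d -> integral_fun (fun j => c j * d j).
Proof.
move=> [A eA] [A' eA']; exists (A *m A').
rewrite map_mxM -mulmxA eA' mulmxA eA -mulmxA mulmx_diag.
by congr (_ *m diag_mx _); apply/rowP => j; rewrite !mxE.
Qed.

Lemma integral_fun_sum (I : Type) (s : seq I) (c : I -> 'I_m -> C) :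
  (forall i, integral_fun (c i)) -> integral_fun (fun j => \sum_(i <- s) c i j).
Proof.
move=> c_int; elim: s => [|i s IHs].
  apply: eq_integral_fun (integral_fun_int 0) => j.
  by rewrite big_nil.
apply: eq_integral_fun (integral_funD (c_int i) IHs) => j.
by rewrite big_cons.
Qed.

Lemma integral_fun_prod (I : Type) (s : seq I) (P : pred I)
    (c : I -> 'I_m -> C) :
  (forall i, integral_fun (c i)) ->
  integral_fun (fun j => \prod_(i <- s | P i) c i j).
Proof.
move=> c_int; elim: s => [|i s IHs].
  apply: eq_integral_fun (integral_fun_int 1) => j.
  by rewrite big_nil.
have [Pi|nPi] := boolP (P i).
  apply: eq_integral_fun (integral_funM (c_int i) IHs) => j.
  by rewrite big_cons Pi.
by apply: eq_integral_fun IHs => j; rewrite big_cons (negPf nPi).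
Qed.

Lemma integral_funX c n : integral_fun c -> integral_fun (fun j => c j ^+ n).
Proof.
move=> c_int; apply: eq_integral_fun
  (integral_fun_prod (index_enum 'I_n) predT (fun=> c_int)) => j.
by rewrite prodr_const card_ord.
Qed.

(** The character table is invertible, so the c j are the eigenvalues of the integer matrix [A] and
    their product is its determinant. *)
Lemma integral_fun_norm c :
  integral_fun c -> exists z : int, \prod_j c j = z%:~R.
Proof.
move=> [A /(congr1 determinant)]; rewrite !det_mulmx det_map_mx det_diag.
have X_neq0 : \det X != 0.
  have [X_unit _] := mulmx1_unit (character_table_inv B).
  by rewrite -unitfE -unitmxE.
rewrite mulrC => /(mulfI X_neq0) eA; exists (\det A); rewrite eA.
by apply: eq_bigr => j _; rewrite mxE.
Qed.

Lemma integral_fun_codegree : integral_fun (fun j => codegree (chi j)).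
Proof.
apply: integral_fun_sum => i; apply: integral_funM; exact: integral_fun_std.
Qed.

End IntegralFunctions.

(** * Interpolation in h_j and existence of a zero *)

Section Zeros.

Variables (C : numClosedFieldType) (H : fusionRing C).
Variables (FPdim : 'AHom(H, C^o)) (B : dualBasis FPdim).
Hypothesis FPdim_gt0 : is_FPdim FPdim.
Hypothesis hB : h_integral B.

Local Notation x := (tnth (std H)).
Local Notation chi := (tnth (mu B)).
Local Notation m := (fr_rank H).+1.

Lemma hhat_gt0 j : 0 < hhat B j.
Proof. by rewrite hhatE // divr_gt0 ?codegree_gt0. Qed.

Lemma hhat_nat : exists h : 'I_m -> nat, forall j, hhat B j = (h j)%:R.
Proof.
have hn j : exists n : nat, hhat B j == n%:R.
  have [z ez] := hB j; exists `|z|%N; rewrite natr_absz ez ger0_norm //.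
  by rewrite -(ler0z C) -ez ltW ?hhat_gt0.
by exists (fun j => xchoose (hn j)) => j; apply/eqP/(xchooseP (hn j)).
Qed.

(* D (h j)^-1 is integral, so polynomial interpolation in it, with cleared
   denominators, gives every function of h j. *)
Lemma integral_fun_interpolation (h : 'I_m -> nat) :
  (forall j, hhat B j = (h j)%:R) ->
  exists2 M : int, M != 0 & forall (c : nat -> 'I_m -> C),
    (forall n, integral_fun B (c n)) ->
    integral_fun B (fun j => M%:~R * c (h j) j).
Proof.
move=> eh; pose D := (\sum_j h j)%N.
have eD : codegree FPdim = D%:R.
  rewrite -(sum_hhat_norm B FPdim_gt0 ord0) natr_sum; apply: eq_bigr => j _.
  by rewrite ahom_std0 normr1 expr1n mulr1 eh.
have h_gt0 j : (0 < h j)%N by rewrite -(ltr0n C) -eh hhat_gt0.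
have en j : (h j)%:R * codegree (chi j) = D%:R.
  by rewrite -eh hhatE // divfK ?eD // gt_eqF ?codegree_gt0.
have D_gt0 : (0 < D)%N by rewrite /D (bigD1 ord0) //= addn_gt0 h_gt0.
have h_le j : (h j <= D)%N by rewrite /D (bigD1 j) //= leq_addr.
pose Mn (n : nat) : int :=
  \prod_(k < D.+1 | k != n :> nat) (D%:Z * (k%:Z - n%:Z)).
(* A Lagrange polynomial in the codegree n_j = D / h_j. Each factor is n (k n_j - D): it vanishes
   when k = h_j, and equals the integer D (k - n) when n = h_j. For n = 0 everything is 0,
   harmlessly since h_j > 0. *)
pose u (n : nat) j : C := \prod_(k < D.+1 | k != n :> nat)
  ((n * k)%N%:Z%:~R * codegree (chi j) + (- (n * D)%N%:Z)%:~R).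
have u_int n : integral_fun B (u n).
  apply: integral_fun_prod => k; apply: integral_funD (integral_fun_int _ _).
  exact: integral_funM (integral_fun_int _ _) (integral_fun_codegree _).
have uE n j : (n < D.+1)%N -> u n j = (Mn n)%:~R *+ (n == h j).
  move=> n_le; have [->|nh] := eqVneq n (h j).
    rewrite mulr1n rmorph_prod; apply: eq_bigr => k _ /=.
    rewrite mulnC !PoszM intrM -mulrA en mulrNz !intrM mulrzBr mulrBr.
    by rewrite mulrC [(h j)%:~R * _]mulrC.
  have h_lt : (h j < D.+1)%N by rewrite ltnS.
  rewrite mulr0n /u (bigD1 (Ordinal h_lt)) 1?eq_sym //= PoszM intrM -mulrA.
  by rewrite en mulrNz PoszM intrM subrr mul0r.
have Mn_neq0 n : Mn n != 0.
  apply/prodf_neq0 => k kn; rewrite mulf_neq0 ?subr_eq0 //.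
  by rewrite eqz_nat -lt0n.
exists (\prod_(n < D.+1) Mn n); first by apply/prodf_neq0 => n _.
move=> c c_int.
(* Only the term n = h_j survives; its [u] supplies the one factor [Mn] missing from M. *)
apply: (@eq_integral_fun _ _ _ _ (fun j => \sum_(n < D.+1)
  ((\prod_(k < D.+1 | k != n) Mn k)%:~R * u n j) * c n j)); last first.
  apply: integral_fun_sum => n; apply: integral_funM (c_int n).
  exact: integral_funM (integral_fun_int _ _) (u_int n).
move=> j; have h_lt : (h j < D.+1)%N by rewrite ltnS.
rewrite (bigD1 (Ordinal h_lt)) //=.
rewrite [X in _ + X]big1 ?addr0 => [|n n_h]; last first.
  have /negPf nh : n != h j :> nat by [].
  by rewrite uE // nh mulr0n mulr0 mul0r.
rewrite uE // eqxx mulr1n -rmorphM; congr (_%:~R * _).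
by rewrite [in RHS](bigD1 (Ordinal h_lt)) //= mulrC.
Qed.

Lemma ahom_std_zero a :
  1 < (FPdim (x a) : C) -> exists j, chi j (x a) = 0 :> C.
Proof.
move=> a_gt1; have [h eh] := hhat_nat.
have [/existsP[j /eqP]|/existsPn chi_neq0] :=
  boolP [exists j, (chi j (x a) : C) == 0]; first by exists j.
have [M M_neq0 M_int] := integral_fun_interpolation eh.
have h_gt0 j : (0 < h j)%N by rewrite -(ltr0n C) -eh hhat_gt0.
pose P : C := \prod_j (chi j (x a) : C) ^+ h j.
have P_ge1 : 1 <= `|P|.
  have P_gt0 : 0 < `|P|.
    rewrite normr_gt0; apply/prodf_neq0 => j _.
    by rewrite expf_neq0 ?chi_neq0.
  (* The functions M mu_j(a)^(k h_j) are integral, and their product over the m characters is M^m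
     P^k. *)
  apply: (@ge1_of_bounded_denominators _ (`|M| ^ m)%N _ _ P_gt0) => [|k].
    by rewrite expn_gt0 absz_gt0 M_neq0.
  have c_int n : integral_fun B (fun j => (chi j (x a) : C) ^+ (n * k)).
    exact: integral_funX (integral_fun_std B a).
  have [z ez] := integral_fun_norm (M_int _ c_int).
  exists `|z|%N; rewrite natr_absz intr_norm -ez big_split /= prodr_const.
  rewrite card_ord normrM normrX -intr_norm -natr_absz natrX -normrX.
  rewrite /P -prodrXl; congr (_ * `|_|).
  by apply: eq_bigr => j _; rewrite exprM.
have sum_h : \sum_j (h j)%:R * `|chi j (x a) : C| ^+ 2 =
    \sum_j (h j)%:R :> C.
  transitivity (codegree FPdim).
    rewrite -(sum_hhat_norm B FPdim_gt0 a).
    by apply: eq_bigr => j _; rewrite eh.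
  rewrite -(sum_hhat_norm B FPdim_gt0 ord0); apply: eq_bigr => j _.
  by rewrite ahom_std0 normr1 expr1n mulr1 eh.
have prod_h : 1 <= \prod_j (`|chi j (x a) : C| ^+ 2) ^+ h j.
  under eq_bigr => j _ do rewrite exprAC -normrX.
  by rewrite prodrXl -normr_prod exprn_ege1.
(* All |mu_j(a)|^2 would be 1; the index [ord0] is that of FPdim, where the value exceeds 1. *)
have := weighted_AGM (fun j => exprn_ge0 2 (normr_ge0 _)) sum_h prod_h
  (h_gt0 ord0).
have FP_gt0 : 0 < (FPdim (x a) : C) := FPdim_gt0 a.
rewrite mu_1 gtr0_norm // => /eqP.
by rewrite gt_eqF // exprn_egt1.
Qed.

End Zeros.

Theorem theorem1p2 (R : realType) (H : fusionRing R[i])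
    (FPdim : 'AHom(H, R[i]^o)) (hFPdim : is_FPdim FPdim)
    (Bhat : dualBasis FPdim) (hBhat : h_integral Bhat)
    (a : H) (ha : a \in std H) (ha1 : 1 < (FPdim a : R[i])) :
  exists2 m : 'AHom(H, R[i]^o), m \in mu Bhat & m a = 0.
Proof.
case/tnthP: ha ha1 => i -> ha1.
have [j chi0] := ahom_std_zero hFPdim hBhat ha1.
by exists (tnth (mu Bhat) j); first exact: mem_tnth.
Qed.
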